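(* Let $n,k$ be integers with $1\le k\le n$. There is a constant $C>0$ depending only on $n$ and $k$ such that the following holds. Let $\mathbb{F}_q$ be a finite field with $q$ elements, let $S$ be a subset of $\mathbb{F}_q^n$, and let $c\in[0,k]$ be a real number. Suppose that, for each $k$-plane $W\subset \mathbb{F}_q^n$, there is a $k$-plane $V\subset\mathbb{F}_q^n$ parallel to $W$ with $|S\cap V|\ge q^c$. Then $$|S| > C q^{cn/k}.$$
   Context: A $k$-plane in $\mathbb{F}_q^n$ is a $k$-dimensional affine subspace (a translate of a $k$-dimensional linear subspace). Two $k$-planes are parallel if they are translates of the same linear subspace. $|\cdot|$ denotes cardinality. *)

(* Defs.v *)
From HB Require Import structures.
From mathcomp Require Import all_boot all_order all_algebra.

Set Implicit Arguments.
Unset Strict Implicit.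
Unset Printing Implicit Defensive.

Import GRing.Theory.
Local Open Scope ring_scope.

Section Planes.
Variables (F : finFieldType) (n : nat).
Implicit Types (U : {vspace 'rV[F]_n}) (x : 'rV[F]_n) (V W : {set 'rV[F]_n}).

Definition translate x U : {set 'rV[F]_n} := [set x + u | u in U].

Definition is_plane (k : nat) V : Prop :=
  exists x U, \dim U = k /\ V = translate x U.

Definition parallel V W : Prop :=
  exists U x y, V = translate x U /\ W = translate y U.

End Planes.

(* Main.v *)
(** Dvir's polynomial method with multiplicities handles [k = 1] for weighted
    point sets. Let [f : F^n -> nat] be bounded by [M], with total mass [N], and
    suppose that every direction contains a line of mass at least [m]. Rounding
    [2 q f / m] down gives multiplicities whose sum along each of these lines is
    at least [q]. If [m^n > (2n)^n M^(n-1) N], there is a nonzero polynomial of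
    degree [< q] vanishing to these multiplicities; it vanishes identically on a
    line in every direction, so its leading form vanishes on all of [F^n], which
    is absurd. Keeping the degree below [q] is what makes the usual
    Schwartz-Zippel step elementary.

    For general [k], project along a direction all of whose lines are light and
    iterate on the pushed-forward weight: the bounds compose to a subspace of
    dimension [k] all of whose translates have mass [m] with
    [m^n <= C M^(n-k) N^k]. *)

Require Import Defs.
From HB Require Import structures.
From mathcomp Require Import all_boot all_order all_algebra.
From mathcomp Require Import reals exp.
From mathcomp Require Import zify ring.

Set Implicit Arguments.
Unset Strict Implicit.
Unset Printing Implicit Defensive.

Import Order.TTheory GRing.Theory Num.Theory.
Local Open Scope ring_scope.

(** * Linear systems, vanishing criteria and Taylor expansion along lines *)

Lemma homogeneous_system_solution (F : fieldType) (A B : finType)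
    (M : B -> A -> F) :
  (#|B| < #|A|)%N ->
  exists2 c : A -> F, exists a, c a != 0 & forall b, \sum_a c a * M b a = 0.
Proof.
move=> ltBA; pose N := \matrix_(i < #|A|, j < #|B|) M (enum_val j) (enum_val i).
have kN0 : kermx N != 0.
  rewrite kermx_eq0 -row_leq_rank -ltnNge.
  by apply: leq_ltn_trans (rank_leq_col N) _.
have /rowV0Pn[v vN v0] := kN0.
exists (fun a => v 0 (enum_rank a)).
  have /rV0Pn[i vi] := v0.
  by exists (enum_val i); rewrite enum_valK.
move=> b; move/sub_kermxP: vN => /rowP/(_ (enum_rank b)); rewrite !mxE => vNb.
rewrite -[RHS]vNb [LHS](reindex_onto enum_val enum_rank) /=; last first.
  by move=> a _; rewrite enum_rankK.
rewrite (eq_bigl xpredT) => [|i]; last by rewrite enum_valK eqxx.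
by apply: eq_bigr => i _; rewrite enum_valK mxE !enum_rankK.
Qed.

(** Powers of distinct linear factors are coprime, so their product divides [p]; its degree exceeds
    that of [p] unless [p = 0]. *)
Lemma poly_eq0_of_multiplicities (F : fieldType) (s : seq F) (g : F -> nat)
    (p : {poly F}) :
  uniq s -> (forall t, t \in s -> ('X - t%:P) ^+ g t %| p) ->
  (size p <= \sum_(t <- s) g t)%N -> p = 0.
Proof.
move=> us dvd_p le_p.
have: \prod_(t <- s) ('X - t%:P) ^+ g t %| p.
  elim: s us dvd_p {le_p} => [|t s IHs] /=; first by rewrite big_nil dvd1p.
  move=> /andP[ts us] dvd_p; rewrite big_cons Gauss_dvdp ?dvd_p ?mem_head //=.
    by apply: IHs => // u us'; apply: dvd_p; rewrite inE us' orbT.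
  rewrite coprimep_expl // coprimep_sym coprimep_XsubC /root horner_prod.
  rewrite prodf_seq_neq0; apply/allP => u us' /=.
  rewrite hornerE hornerXsubC expf_neq0 // subr_eq0.
  by apply: contraNneq ts => ->.
apply: contraTeq => p0; apply: contraL le_p => /(dvdp_leq p0).
rewrite -ltnNge; apply: leq_trans.
rewrite size_prod_seq => [|t _]; last by rewrite expf_neq0 ?polyXsubC_eq0.
under [in X in (_ < X)%N]eq_bigr do rewrite size_exp_XsubC -addn1.
by rewrite big_split /= sum1_size subSn ?leq_addl ?addnK.
Qed.

(** A row vector killing the Vandermonde matrix [A] lists the coefficients of a polynomial of size
    at most [D] with all of [F] as roots, hence is zero. So [A] has a right inverse, whose entries
    read coefficients off values. *)
Lemma dual_weights (F : finFieldType) (D : nat) : (D <= #|F|)%N ->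
  exists w : F -> 'I_D -> F,
    forall i j : 'I_D, \sum_t t ^+ i * w t j = (i == j)%:R.
Proof.
move=> leD; pose A := \matrix_(i < D, t < #|F|) (enum_val t : F) ^+ i.
have /row_freeP[B AB] : row_free A.
  rewrite -kermx_eq0; apply/rowV0P => v /sub_kermxP vA.
  pose p := \poly_(i < D) (if insub i is Some k then v 0 k else 0).
  have pE t : p.[t] = 0.
    rewrite horner_poly; move/rowP: vA => /(_ (enum_rank t)); rewrite !mxE => vAt.
    by rewrite -[RHS]vAt; apply: eq_bigr => i _; rewrite valK !mxE enum_rankK.
  have p0 : p = 0.
    apply/eqP; apply: contraTT leD => p0; rewrite -ltnNge.
    apply: leq_trans (size_poly _ _ : (size p <= D)%N).
    rewrite cardE; apply: max_poly_roots => //; last exact: enum_uniq.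
    by apply/allP => t _; apply/rootP.
  apply/rowP => i; rewrite mxE.
  have := coef_poly D (fun i => if insub i is Some k then v 0 k else 0) i.
  by rewrite -/p p0 coef0 ltn_ord valK.
exists (fun t j => B (enum_rank t) j) => i j.
move/matrixP: AB => /(_ i j); rewrite !mxE => <-.
rewrite [LHS](reindex_onto enum_val enum_rank) /=; last first.
  by move=> a _; rewrite enum_rankK.
rewrite (eq_bigl xpredT) => [|t]; last by rewrite enum_valK eqxx.
by apply: eq_bigr => t _; rewrite enum_valK mxE.
Qed.

(** Summing the values against a product of dual weights factors over the coordinates and isolates
    [c e0]. *)
Lemma reduced_poly_eq0 (F : finFieldType) (n D : nat)
    (c : {ffun 'I_n -> 'I_D} -> F) : (D <= #|F|)%N ->
  (forall x : 'rV[F]_n, \sum_e c e * \prod_i x 0 i ^+ e i = 0) ->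
  forall e, c e = 0.
Proof.
move=> leD vanish e0; have [w wE] := dual_weights leD.
have : \sum_(x : {ffun 'I_n -> F})
   (\sum_e c e * \prod_i x i ^+ e i) * \prod_i w (x i) (e0 i) = 0.
  apply: big1 => x _; suff -> : \sum_e c e * \prod_i x i ^+ e i = 0 by rewrite mul0r.
  rewrite -[RHS](vanish (\row_i x i)); apply: eq_bigr => e _.
  by congr (_ * _); apply: eq_bigr => i _; rewrite mxE.
have factor e : \sum_(x : {ffun 'I_n -> F})
    (c e * \prod_i x i ^+ e i) * \prod_i w (x i) (e0 i) =
    c e * \prod_i (e i == e0 i)%:R.
  transitivity (c e * \prod_i \sum_t t ^+ e i * w t (e0 i)).
    rewrite bigA_distr_bigA mulr_sumr; apply: eq_bigr => x _.
    by rewrite -mulrA -big_split.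
  by congr (_ * _); apply: eq_bigr => i _; rewrite wE.
rewrite (eq_bigr _ (fun x _ => mulr_suml _ _ _ _)) exchange_big /=.
rewrite (eq_bigr _ (fun e _ => factor e)) (bigD1 e0) //=.
rewrite [X in _ * X]big1 => [|i _]; last by rewrite eqxx.
rewrite big1 ?addr0 ?mulr1 // => e e_neq.
have /existsP[i ei] : [exists i, e i != e0 i].
  rewrite -negb_forall; apply: contra e_neq => /forallP ee.
  by apply/eqP/ffunP => i; apply/eqP.
by rewrite (bigD1 i) //= (negPf ei) mul0r mulr0.
Qed.

(* A polynomial P in n variables with partial degrees < D is represented by its
   coefficient function c; hasse c x al is the coefficient of y^al in P(x + y). *)
Definition hasse (F : comNzRingType) (n D : nat)
    (c : {ffun 'I_n -> 'I_D} -> F) (x : 'rV[F]_n) (al : 'I_n -> nat) : F :=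
  \sum_e c e * \prod_i (x 0 i ^+ (e i - al i) *+ 'C(e i, al i)).

(* P(a + X b) *)
Definition line_poly (F : comNzRingType) (n D : nat)
    (c : {ffun 'I_n -> 'I_D} -> F) (a b : 'rV[F]_n) : {poly F} :=
  \sum_e c e *: \prod_i ((a 0 i)%:P + b 0 i *: 'X) ^+ e i.

(** Expand P at [x = a + t b], using [a + X b = x + (X - t) b]. Vanishing of the low-order Hasse
    coefficients at [x] then shows up as a power of [X - t] dividing the restriction to the line. *)
Lemma line_poly_taylor (F : comNzRingType) (n D : nat)
    (c : {ffun 'I_n -> 'I_D} -> F) (a b : 'rV[F]_n) (t : F) :
  line_poly c a b =
    \sum_(al : {ffun 'I_n -> 'I_D})
      (hasse c (a + t *: b) (fun i => al i) * \prod_i b 0 i ^+ al i)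
        *: ('X - t%:P) ^+ (\sum_i al i).
Proof.
set x := a + t *: b.
have expand (m : 'I_D) i : ((a 0 i)%:P + b 0 i *: 'X) ^+ m =
    \sum_(j < D) (x 0 i ^+ (m - j) *+ 'C(m, j) * b 0 i ^+ j) *: ('X - t%:P) ^+ j.
  have -> : (a 0 i)%:P + b 0 i *: 'X = (x 0 i)%:P + b 0 i *: ('X - t%:P).
    by rewrite !mxE -!mul_polyC polyCD polyCM; ring.
  rewrite exprDn.
  pose G j := (x 0 i ^+ (m - j) *+ 'C(m, j) * b 0 i ^+ j) *: ('X - t%:P) ^+ j.
  rewrite (eq_bigr (fun j : 'I_m.+1 => G j)) => [|j _].
    rewrite (big_ord_widen D G) // /G [RHS](bigID (fun j : 'I_D => j < m.+1)%N) /=.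
    rewrite [X in _ = _ + X]big1 ?addr0 // => j; rewrite -leqNgt => mj.
    by rewrite bin_small // mulr0n mul0r scale0r.
  rewrite /G exprZn -polyC_exp mul_polyC scalerA scalerMnl.
  by rewrite mulrnAl.
transitivity (\sum_e \sum_(al : {ffun 'I_n -> 'I_D})
    (c e * (\prod_i (x 0 i ^+ (e i - al i) *+ 'C(e i, al i))) *
       \prod_i b 0 i ^+ al i) *: ('X - t%:P) ^+ (\sum_i al i)).
  apply: eq_bigr => e _; under eq_bigr => i _ do rewrite (expand (e i) i).
  rewrite (bigA_distr_bigA (fun i (j : 'I_D) =>
    (x 0 i ^+ (e i - j) *+ 'C(e i, j) * b 0 i ^+ j) *: ('X - t%:P) ^+ j)) /=.
  rewrite scaler_sumr; apply: eq_bigr => al _.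
  by rewrite scaler_prod big_split prodrXr scalerA mulrA.
rewrite exchange_big; apply: eq_bigr => al _ /=.
by rewrite -scaler_suml -mulr_suml.
Qed.

(** * The method of multiplicities *)

(** Conditions at [x] range over the box of exponents below [g x]: this is [g x ^ n] equations,
    against [D ^ n] unknown coefficients. If the bound failed, a nonzero solution P would exist. *)
Lemma kakeya_multiplicities (F : finFieldType) (n D : nat)
    (g : 'rV[F]_n -> nat) :
  (0 < n)%N -> (n * D.-1 < #|F|)%N ->
  (forall b : 'rV[F]_n, b != 0 ->
     exists a, (#|F| <= \sum_(t : F) g (a + t *: b)%R)%N) ->
  (D ^ n <= \sum_x g x ^ n)%N.
Proof.
move=> n_gt0 ltDF big_lines; rewrite leqNgt; apply/negP => lt_gD.
have leDF : (D <= #|F|)%N by case: (D) ltDF n_gt0 => // D' /=; nia.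
have [] := @homogeneous_system_solution F {ffun 'I_n -> 'I_D}
  {x : 'rV[F]_n & {ffun 'I_n -> 'I_(g x)}}
  (fun u e => \prod_i (tag u 0 i ^+ (e i - tagged u i) *+ 'C(e i, tagged u i))).
  rewrite card_tagged card_ffun !card_ord sumnE big_map big_enum /=.
  by under eq_bigr do rewrite card_ffun !card_ord.
move=> c [e1 ce1] cM.
have hasse0 x (al : 'I_n -> nat) : (forall i, al i < g x)%N -> hasse c x al = 0.
  move=> lt_al; have := cM (Tagged _ [ffun i => Ordinal (lt_al i)]).
  move=> cMx; rewrite -[RHS]cMx; apply: eq_bigr => e _; congr (_ * _).
  by apply: eq_bigr => i _; rewrite ffunE.
have line0 (b : 'rV[F]_n) : b != 0 -> exists a, line_poly c a b = 0.
  move=> /big_lines[a le_g]; exists a.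
  apply: (@poly_eq0_of_multiplicities F (enum F) (fun t : F => g (a + t *: b)%R)).
  - exact: enum_uniq.
  - move=> t _; rewrite (line_poly_taylor _ _ _ t).
    apply: (big_ind (fun p => _ %| p)) => [|p r|al _].
    - exact: dvdp0.
    - exact: dvdp_add.
    have [le_al|lt_al] := leqP (g (a + t *: b)%R) (\sum_i al i).
      by rewrite -mul_polyC dvdp_mull // dvdp_exp2l.
    rewrite (hasse0 _ (fun i => al i)) ?mul0r ?scale0r ?dvdp0 // => i.
    by apply: leq_ltn_trans lt_al; rewrite (bigD1 i) //= leq_addr.
  rewrite [X in (_ <= X)%N]big_enum /=; apply: leq_trans le_g.
  (* Expanding at [0] bounds the degree on the line by [n * D.-1]. *)
  rewrite (line_poly_taylor _ _ _ 0); apply: (leq_trans (size_sum _ _ _)).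
  apply/bigmax_leqP => al _; apply: (leq_trans (size_scale_leq _ _)).
  rewrite size_exp_XsubC; apply: leq_ltn_trans ltDF.
  rewrite -[X in (_ <= X * _)%N](card_ord n) -sum_nat_const.
  by apply: leq_sum => i _; case: (al i) => /= m; case: (D).
pose d := \max_(e | c e != 0) \sum_i e i.
have le_d e : c e != 0 -> (\sum_i e i <= d)%N.
  by move=> ce; 
  exact: (@leq_bigmax_cond _ [pred e | c e != 0]
    (fun e : {ffun 'I_n -> 'I_D} => \sum_i e i)%N).
(* Exponents with nonzero coefficient have total at most [d], so [al <= e] forces [e = al];
   top-order Hasse coefficients are thus independent of [x]. *)
have hasse_top x (al : {ffun 'I_n -> 'I_D}) :
    (\sum_i al i)%N = d -> hasse c x (fun i => al i) = c al.
  move=> al_d; rewrite /hasse (bigD1 al) //= [X in _ * X]big1 => [|i _]; last first.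
    by rewrite subnn binn.
  rewrite mulr1 big1 ?addr0 // => e e_al; have [-> |ce] := eqVneq (c e) 0.
    by rewrite mul0r.
  have [/forallP le_al|] := boolP [forall i, al i <= e i]%N; last first.
    rewrite negb_forall => /existsP[i]; rewrite -ltnNge => lt_e.
    by rewrite (bigD1 i) //= bin_small // mulr0n mul0r mulr0.
  case/eqP: e_al; apply/ffunP => i; apply/val_inj => /=.
  have := le_d e ce; rewrite -al_d.
  rewrite (geq_leqif (leqif_sum (fun i _ => leqif_eq (le_al i)))).
  by move=> /forallP/(_ i)/eqP ->.
pose ctop (e : {ffun 'I_n -> 'I_D}) := if (\sum_i e i == d)%N then c e else 0.
(* The coefficient of [X^d] in P(a + X b) is the leading form at [b]. *)
have top0 (b : 'rV[F]_n) : b != 0 -> \sum_e ctop e * \prod_i b 0 i ^+ e i = 0.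
  move=> /line0[a]; rewrite (line_poly_taylor _ _ _ 0) => /(congr1 (coefp d)).
  rewrite /= coef0 coef_sum => La0; rewrite -[RHS]La0; apply: eq_bigr => al _.
  rewrite polyC0 subr0 coefZ coefXn /ctop [d == _]eq_sym.
  by case: eqP => [/hasse_top-> | _]; rewrite ?mulr1 ?mulr0 ?mul0r.
have [e2 ce2 e2d] : {e | c e != 0 & (\sum_i e i)%N = d}.
  have := @eq_bigmax_cond _ [pred e | c e != 0]
    (fun e : {ffun 'I_n -> 'I_D} => \sum_i e i)%N.
  case=> [|e ce ed]; first by apply/card_gt0P; exists e1.
  by exists e.
case/eqP: ce2; rewrite -(_ : ctop e2 = c e2); last by rewrite /ctop e2d eqxx.
apply: (reduced_poly_eq0 leDF _ e2) => b.
have [-> |/top0//] := eqVneq b 0.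
(* At [b = 0], which is no direction, a form of positive degree vanishes anyway; a constant form
   equals its value at the all-ones vector. *)
have [d0|d_gt0] := posnP d; last first.
  apply: big1 => e _; rewrite /ctop; case: eqP => [ed|_]; last by rewrite mul0r.
  have /existsP[i ei] : [exists i, 0 < e i]%N.
    apply: contraLR d_gt0; rewrite negb_exists -eqn0Ngt -ed => /forallP e0.
    by rewrite sum_nat_eq0; apply/forallP => i; rewrite /= eqn0Ngt.
  by rewrite (bigD1 i) //= mxE expr0n gtn_eqF // mul0r mulr0.
have one_n0 : const_mx 1 != 0 :> 'rV[F]_n.
  by apply/rV0Pn; exists (Ordinal n_gt0); rewrite mxE oner_neq0.
rewrite -[RHS](top0 _ one_n0); apply: eq_bigr => e _.
rewrite /ctop; case: eqP => [ed|]; last by rewrite !mul0r.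
congr (_ * _); apply: eq_bigr => i _.
have /eqP : (\sum_i e i)%N = 0%N by rewrite ed.
by rewrite sum_nat_eq0 => /forallP/(_ i)/eqP ->.
Qed.

(** * Light lines in a weighted point set *)

Lemma leq_expn2r (e m n : nat) : (m <= n)%N -> (m ^ e <= n ^ e)%N.
Proof. by case: e => // e; rewrite leq_exp2r. Qed.

Lemma direction_with_light_lines (F : finFieldType) (n M : nat)
    (f : 'rV[F]_n -> nat) :
  (0 < n)%N -> (forall x, f x <= M)%N ->
  exists2 b : 'rV[F]_n, b != 0 &
  exists2 m : nat, (m ^ n <= (2 * n) ^ n * M ^ n.-1 * \sum_x f x)%N &
    forall a, (\sum_(t : F) f (a + t *: b)%R <= m)%N.
Proof.
move=> n_gt0 fM; set K := (_ * \sum_x f x)%N.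
have exK : exists m, (K < m ^ n)%N.
  exists K.+1; apply: leq_trans (leqnn K.+1) _.
  by rewrite -{1}[K.+1]expn1 leq_pexp2l.
(* By minimality [m.-1] meets the required bound; if it fails as a line bound, every direction has a
   line of mass at least [m]. *)
case: (ex_minnP exK) => m ltKm min_m.
have m_gt0 : (0 < m)%N by case: (m) ltKm => //; rewrite exp0n.
have leK : (m.-1 ^ n <= K)%N.
  rewrite leqNgt; apply/negP => /min_m; lia.
have [/existsP[b /andP[b0 /forallP lb]]|] := boolP [exists b : 'rV[F]_n,
    (b != 0) && [forall a, \sum_(t : F) f (a + t *: b)%R <= m.-1]%N].
  by exists b => //; exists m.-1.
rewrite negb_exists => /forallP heavy; exfalso.
have {}heavy (b : 'rV[F]_n) : b != 0 ->
    exists a, (m <= \sum_(t : F) f (a + t *: b)%R)%N.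
  move=> b0; have := heavy b; rewrite b0 /= negb_forall => /existsP[a].
  by rewrite -ltnNge prednK // => ?; exists a.
pose q := #|F|; have q_gt0 : (0 < q)%N by apply/card_gt0P; exists 0.
(* The factor 2 pays for rounding: less than 1 is lost at each of the [q] points of a line, leaving
   at least [2 * q - q]. *)
pose g x := ((2 * q * f x) %/ m)%N.
(* The largest [D] with [n * D.-1 < q], so that also [q <= n * D]. *)
pose D := (q.-1 %/ n).+1.
have nD : (n * D.-1 < q)%N.
  by rewrite /= mulnC -[X in (_ < X)%N](prednK q_gt0) ltnS leq_trunc_div.
have leqD : (q <= n * D)%N.
  by rewrite -[X in (X <= _)%N](prednK q_gt0) mulnC ltn_ceil.
have leDg : (D ^ n <= \sum_x g x ^ n)%N.
  apply: kakeya_multiplicities n_gt0 nD _ => b /heavy[a ma]; exists a.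
  rewrite -/q -(leq_pmul2l m_gt0) -(leq_add2r (m * q)).
  apply: (@leq_trans (2 * q * \sum_(t : F) f (a + t *: b)%R)); first nia.
  rewrite !big_distrr /= -[q in (_ + m * q)%N]sum1_card big_distrr -big_split /=.
  apply: leq_sum => t _; rewrite muln1 -mulnSr.
  by rewrite [X in (_ <= X)%N]mulnC ltnW // ltn_ceil.
(* Uses [m * g x <= 2 * q * f x] and [f x ^ n <= M ^ n.-1 * f x]; cancelling [q ^ n] contradicts the
   choice of [m]. *)
have : ((q * m) ^ n <= q ^ n * K)%N.
  apply: (@leq_trans (n ^ n * (m ^ n * D ^ n))).
    by rewrite -!expnMn leq_exp2r //; nia.
  apply: (@leq_trans (n ^ n * \sum_x (2 * q * f x) ^ n)).
    rewrite leq_mul2l; apply/orP; right.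
    apply: (leq_trans (leq_mul (leqnn _) leDg)); rewrite big_distrr /=.
    by apply: leq_sum => x _; rewrite -expnMn leq_exp2r // mulnC leq_trunc_div.
  apply: (@leq_trans (n ^ n * (2 ^ n * q ^ n * (M ^ n.-1 * \sum_x f x)))).
    rewrite leq_mul2l !big_distrr /=; apply/orP; right; apply: leq_sum => x _.
    rewrite !expnMn leq_mul //; case: (n) n_gt0 => //= n' _.
    by rewrite expnSr leq_mul // leq_expn2r.
  by apply: eq_leq; rewrite /K !expnMn; ring.
by rewrite expnMn leq_pmul2l ?expn_gt0 ?q_gt0 // leqNgt ltKm.
Qed.

(** * Projection and induction on the dimension *)

(** Where [b] has a nonzero coordinate [i], send [x] to [x - (x_i / b_i) b] and drop coordinate [i];
    surjectivity is rank-nullity. *)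
Lemma projection_along (F : fieldType) (n : nat) (b : 'rV[F]_n.+1) :
  b != 0 -> exists2 phi : 'Hom('rV[F]_n.+1, 'rV[F]_n),
    lker phi = <[b]>%VS & limg phi = fullv.
Proof.
move=> b0; have /rV0Pn[i bi] := b0.
pose B := \matrix_(r < n.+1, j < n)
  ((r == lift i j)%:R - (r == i)%:R * (b 0 (lift i j) / b 0 i)).
have mulB x j : (x *m B) 0 j = x 0 (lift i j) - x 0 i * (b 0 (lift i j) / b 0 i).
  rewrite mxE; under eq_bigr do rewrite mxE mulrBr.
  rewrite sumrB (bigD1 (lift i j)) //= eqxx mulr1 big1 ?addr0; last first.
    by move=> r /negPf->; rewrite mulr0.
  rewrite (bigD1 i) //= eqxx mul1r big1 ?addr0 // => r /negPf->.
  by rewrite mul0r mulr0.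
pose phi := linfun (mulmxr B : 'rV_n.+1 -> 'rV_n).
have kerE : lker phi = <[b]>%VS.
  apply/vspaceP => x; rewrite memv_ker lfunE /=; apply/eqP/vlineP.
    move=> xB; exists (x 0 i / b 0 i); apply/rowP => r; rewrite mxE.
    have [j ->|->] := unliftP i r; last by rewrite divfK.
    move/rowP/(_ j): xB; rewrite mulB mxE => /eqP; rewrite subr_eq0 => /eqP->.
    by rewrite mulrCA mulrC.
  case=> t ->; apply/rowP => j; rewrite mulB !mxE.
  by rewrite -mulrA [_ * (_ / _)]mulrC divfK // subrr.
exists phi => //; apply/eqP; rewrite eqEdim subvf /=.
have := limg_ker_dim phi fullv.
rewrite capfv kerE dim_vline b0 !dimvf /dim /= !mul1n; lia.
Qed.

(** Induction on [k]: pushing [f] forward along a light direction replaces [M] by the line bound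
    [m], and taking the preimage of the subspace found below adds one dimension. *)
Lemma subspace_with_light_translates (n k : nat) : (k <= n)%N ->
  exists2 C : nat, (0 < C)%N &
  forall (F : finFieldType) (f : 'rV[F]_n -> nat) (M : nat),
    (forall x, f x <= M)%N ->
    exists2 U : {vspace 'rV[F]_n}, \dim U = k &
      forall x, ((\sum_(u in U) f (x + u)%R) ^ n
                 <= C * M ^ (n - k) * (\sum_x f x) ^ k)%N.
Proof.
elim: k n => [|k IHk] n le_kn.
  exists 1%N => // F f M fM; exists 0%VS; first exact: dimv0.
  move=> x; rewrite (big_pred1 0) => [|u]; last by rewrite memv0.
  by rewrite addr0 mul1n subn0 muln1 leq_expn2r.
case: n le_kn => // n le_kn.
(* A one-dimensional ambient space is treated apart, since the general step compares [n]-th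
   powers. *)
have [n0|n_gt0] := posnP n.
  have k0 : k = 0%N by lia.
  subst n k; exists 1%N => // F f M fM; exists fullv.
    by rewrite dimvf /dim /= mul1n.
  move=> x; rewrite !mul1n !expn1.
  rewrite [X in (_ <= X)%N](reindex_inj (addrI x)) /=.
  by apply: eq_leq; apply: eq_bigl => u; rewrite memvf.
have [C C_gt0 lightC] := IHk n le_kn.
pose A := ((2 * n.+1) ^ n.+1)%N.
have A_gt0 : (0 < A)%N by rewrite expn_gt0.
(* This product arises in a bound on the [n]-th power; being a positive integer, it is at most its
   own [n]-th power, so no root is taken. *)
exists (C ^ n.+1 * A ^ (n - k))%N; first by rewrite muln_gt0 !expn_gt0 C_gt0.
move=> F f M fM; set N := (\sum_x f x)%N.
have [b b0 [m mA line_m]] := direction_with_light_lines (ltn0Sn n) fM.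
have [phi kerE imgE] := projection_along b0.
pose h y := (\sum_(z | phi z == y) f z)%N.
have hm y : (h y <= m)%N.
  have /memv_imgP[z _ ->] : y \in limg phi by rewrite imgE memvf.
  apply: leq_trans (line_m z); rewrite /h.
  rewrite (reindex_inj (addrI z)) /=.
  (* Shifted to the origin, a fibre of [phi] is the line spanned by [b]. *)
  rewrite (eq_bigl (mem [set t *: b | t : F])); last first.
    move=> u; rewrite linearD /= -subr_eq0 addrC addKr -memv_ker kerE.
    apply/vlineP/imsetP => [[t ->]|[t _ ->]]; by exists t.
  rewrite big_imset //= => t u _ _ /eqP; rewrite -subr_eq0 -scalerBl scaler_eq0.
  by rewrite (negPf b0) orbF subr_eq0 => /eqP.
have hN : (\sum_y h y = N)%N.
  by rewrite /N (partition_big phi predT).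
have [W dimW lightW] := lightC F h m hm.
exists (phi @^-1: W)%VS.
  have := limg_ker_dim phi (phi @^-1: W)%VS.
  rewrite lpreimK ?imgE ?subvf // dimW (capv_idPr _); last first.
    by rewrite -lpreim0 lpreimS // sub0v.
  by rewrite kerE dim_vline b0 add1n.
move=> x.
have -> : (\sum_(u in (phi @^-1: W)%VS) f (x + u)%R =
           \sum_(w in W) h (phi x + w)%R)%N.
  rewrite (partition_big phi (mem W)) => [|u]; last by rewrite -memv_preim.
  apply: eq_bigr => w wW; rewrite /h [RHS](reindex_inj (addrI x)) /=.
  apply: eq_bigl => u; rewrite linearD (inj_eq (addrI _)) -memv_preim.
  by case: eqP => [->|]; rewrite ?andbF ?andbT.
have := lightW (phi x); rewrite hN; set s := (\sum_(w in W) _)%N => sC.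
(* After raising to the power [n], and [sC] to the power [n.+1], [m] enters only through [m ^ n.+1],
   which [mA] controls. *)
rewrite subSS -(@leq_exp2r _ _ n) //.
apply: (@leq_trans ((C * m ^ (n - k) * N ^ k) ^ n.+1)).
  by rewrite -expnM mulnC expnM leq_exp2r.
rewrite !expnMn -expnM [((n - k) * _)%N]mulnC [(m ^ _)%N]expnM.
apply: (@leq_trans (C ^ n.+1 * (A * M ^ n * N) ^ (n - k) * (N ^ k) ^ n.+1)).
  by rewrite leq_mul // leq_mul // leq_expn2r.
have expand_ge a : (0 < a)%N -> (a <= a ^ n)%N.
  by move=> a_gt0; rewrite -[X in (X <= _)%N]expn1 leq_pexp2l.
have -> : ((N ^ k.+1) ^ n = N ^ (n - k) * (N ^ k) ^ n.+1)%N.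
  by rewrite -!expnM -expnD; congr (_ ^ _)%N; nia.
rewrite !expnMn -[((M ^ n) ^ _)%N]expnM -[((M ^ _) ^ n)%N]expnM [(n * _)%N]mulnC.
rewrite !mulnA leq_mul // leq_mul // leq_mul //.
by rewrite leq_mul // expand_ge // expn_gt0 ?C_gt0 ?A_gt0.
Qed.

(** * From weights to point sets and planes *)

Theorem proposition1p4 (R : realType) (n k : nat) (hk : (1 <= k <= n)%N) :
  exists C : R, 0 < C /\
    forall (F : finFieldType) (S : {set 'rV[F]_n}) (c : R),
      0 <= c <= k%:R ->
      (forall W : {set 'rV[F]_n}, is_plane k W ->
         exists V : {set 'rV[F]_n},
           [/\ is_plane k V, parallel V W &
               #|F|%:R `^ c <= #|S :&: V|%:R]) ->
      #|S|%:R > C * #|F|%:R `^ (c * n%:R / k%:R).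

Proof.
have /andP[k_gt0 le_kn] := hk.
have [A A_gt0 light] := subspace_with_light_translates le_kn.
have A2_gt0 : 0 < (2 * A)%:R :> R by rewrite ltr0n muln_gt0.
(* The 2 ensures [A < (2 * A) ^ k], which makes the final inequality strict. *)
exists (2 * A)%:R^-1; split; first by rewrite invr_gt0.
move=> F S c _ planes.
(* The weight is the indicator of [S], bounded by [M = 1]. *)
have [|U dimU lightU] := light F (fun x => x \in S : nat) 1%N.
  by move=> x; case: (x \in S).
have [|V [_ [U' [x [y [VE WE]]]] heavyV]] := planes (translate 0 U).
  by exists 0, U.
(* The common direction [U'] supplied by [parallel] must be [U]: as [0] lies in [U], the shift [y]
   lies in [U']. *)
have memW u : (u \in U) = (u - y \in U').
  have -> : (u \in U) = (u \in translate 0 U).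
    apply/idP/imsetP => [uU|[v vU ->]]; last by rewrite add0r.
    by exists u; rewrite ?add0r.
  rewrite WE; apply/imsetP/idP => [[v vU ->]|uU]; first by rewrite addrC addKr.
  by exists (u - y); rewrite // addrC subrK.
have UE : U' = U.
  have yU' : y \in U' by rewrite -memvN -sub0r -memW mem0v.
  apply/vspaceP => u; rewrite memW.
  by rewrite rpredBr.
have lightV : (#|S :&: V| ^ n <= A * #|S| ^ k)%N.
  have := lightU x; rewrite exp1n muln1.
  have -> : (\sum_z (z \in S) = #|S|)%N by rewrite -big_mkcond sum1_card.
  suff -> : (\sum_(u in U) ((x + u)%R \in S) = #|S :&: V|)%N by [].
  rewrite setIC VE UE -sum1_card -big_mkcondr /=.
  rewrite [RHS](reindex_inj (addrI x)) /=; apply: eq_bigl => u.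
  by rewrite inE (mem_imset _ _ (addrI x)).
set T := _ `^ (c * _ / _).
have q_gt0 : 0 < #|F|%:R :> R by rewrite ltr0n; apply/card_gt0P; exists 0.
have T_gt0 : 0 < T by rewrite powR_gt0.
have TkE : T ^+ k = (#|F|%:R `^ c) ^+ n.
  rewrite -!powR_mulrn ?powR_ge0 // -!powRrM divfK //.
  by rewrite pnatr_eq0 -lt0n.
have leT : T ^+ k <= A%:R * #|S|%:R ^+ k.
  rewrite TkE (le_trans (lerXn2r n _ _ heavyV)) ?nnegrE ?powR_ge0 //.
  by rewrite -!natrX -natrM ler_nat.
rewrite ltNge; apply/negP => leS.
have : (2 * A)%:R ^+ k * (A%:R * #|S|%:R ^+ k) <= A%:R * T ^+ k.
  rewrite mulrCA -exprMn ler_pM2l ?ltr0n //.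
  by rewrite ler_pXn2r ?nnegrE ?mulr_ge0 ?(ltW T_gt0) // -ler_pdivlMl.
apply/negP; rewrite -ltNge.
apply: lt_le_trans (ler_wpM2l _ leT); last by rewrite exprn_ge0 // ltW.
rewrite ltr_pM2r ?exprn_gt0 // -natrX ltr_nat.
apply: (@leq_trans (2 * A)); first by lia.
by rewrite -{1}[(2 * A)%N]expn1 leq_pexp2l // muln_gt0.
Qed.
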